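(* Fix $\gamma > 0$ and integers $\ell, r, s$ with $\ell \ge 1$, $r \ge 0$ and $s \ge \max\{1+2r, 2\}$, and let $(G,c)$ be a sufficiently large $n$-vertex edge-colored graph (that is, $n \ge n_0$ for some $n_0$ depending only on $\gamma, \ell, r, s$). (i) If $\mathbb{E}[d^c_G(v)] \ge \left(1 - \frac{1}{s-1} + \gamma\right) n$, then $(G,c)$ contains a rainbow $K_{\lfloor s/2 \rfloor} \vee K^{\ell}_{\lceil s/2 \rceil}$ (which contains $K_s$). (ii) If $\mathbb{E}[d^c_G(v)] \ge \left(1 - \frac{1}{2(s-1-r)} + \gamma\right) n$, then $(G,c)$ contains a rainbow $K_r \vee K^{\ell}_{s-r}$ (which is $K^{\ell}_s$ when $r = 0$). Moreover, these results are asymptotically sharp.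
   Context: An $n$-vertex edge-colored graph $(G,c)$ consists of a finite simple $n$-vertex graph $G=(V,E)$ and an arbitrary function $c : E \to \mathbb{N}$ (not necessarily a proper coloring). A subgraph $H \subseteq G$ (not necessarily induced) is rainbow if $c$ is injective on $E(H)$. The color degree $d^c_G(v)$ of $v \in V$ is the number of distinct colors appearing on edges incident to $v$, and $\mathbb{E}[d^c_G(v)] = \frac{1}{|V|}\sum_{v \in V} d^c_G(v)$ is the average color degree. $K^{\ell}_t$ denotes the complete $t$-partite graph all of whose $t$ parts have size $\ell$. $K_r$ is the complete graph on $r$ vertices, with $K_0$ the empty graph. For vertex-disjoint graphs $A$ and $B$, the join $A \vee B$ consists of $A$, $B$, and all edges between $V(A)$ and $V(B)$.
   Formalization: Asymptotic sharpness of (ii) is stated only for s ≤ ℓ + 2r, exactly where it holds: otherwise (i) yields a smaller constant (e.g. ℓ = 1, r = 0, s = 3: the target is K_3, for which 1/2 suffices instead of 3/4). *)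

(* Defs.v *)
From HB Require Import structures.
From mathcomp Require Import all_boot all_order all_algebra.
From mathcomp Require Import reals.

Set Implicit Arguments.
Unset Strict Implicit.
Unset Printing Implicit Defensive.

Import Order.TTheory GRing.Theory Num.Theory.

Local Open Scope ring_scope.

Record sgraph (V : finType) := SGraph {
  adj :> rel V;
  adj_sym : symmetric adj;
  adj_irrefl : irreflexive adj }.

Definition edges (V : finType) (G : sgraph V) : {set {set V}} :=
  [set [set p.1; p.2] | p : V * V & G p.1 p.2].

(* An edge coloring of [G] is given by a function on all subsets of [V]; only
   its values on [edges G] are ever used. *)
Definition coloring (V : finType) := {set V} -> nat.

Definition color_degree (V : finType) (G : sgraph V) (c : coloring V) (v : V) :
    nat :=
  size (undup [seq c e | e : {set V} <- enum (edges G) & v \in e]).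

Definition avg_color_degree (R : realType) (V : finType) (G : sgraph V)
    (c : coloring V) : R :=
  (\sum_(v : V) (color_degree G c v)%:R) / #|V|%:R.

(* The subgraph of [G] isomorphic to [F] is the image of [F] under [f]; its
   edge set is [[set f @: e | e in edges F]]. *)
Definition contains_rainbow (V W : finType) (G : sgraph V) (c : coloring V)
    (F : sgraph W) : Prop :=
  exists f : W -> V,
    [/\ injective f,
        {homo f : u v / F u v >-> G u v}
      & {in [set f @: (e : {set W}) | e in edges F] &, injective c}].

Lemma complete_sym (T : finType) : symmetric (fun x y : T => x != y).
Proof. by move=> x y; rewrite eq_sym. Qed.

Lemma complete_irrefl (T : finType) : irreflexive (fun x y : T => x != y).
Proof. by move=> x; rewrite eqxx. Qed.

Definition complete (r : nat) : sgraph 'I_r :=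
  SGraph (@complete_sym 'I_r) (@complete_irrefl 'I_r).

Lemma multipartite_sym (t l : nat) :
  symmetric (fun x y : 'I_t * 'I_l => x.1 != y.1).
Proof. by move=> x y; rewrite eq_sym. Qed.

Lemma multipartite_irrefl (t l : nat) :
  irreflexive (fun x y : 'I_t * 'I_l => x.1 != y.1).
Proof. by move=> x; rewrite eqxx. Qed.

(* $K^l_t$: the vertex [(i, k)] is the [k]-th vertex of the [i]-th part. *)
Definition multipartite (t l : nat) : sgraph ('I_t * 'I_l)%type :=
  SGraph (@multipartite_sym t l) (@multipartite_irrefl t l).

Definition join_rel (A B : finType) (G : sgraph A) (H : sgraph B) :
    rel (A + B)%type :=
  fun x y => match x, y with
             | inl a, inl a' => G a a'
             | inr b, inr b' => H b b'
             | _, _ => true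
             end.

Lemma join_sym (A B : finType) (G : sgraph A) (H : sgraph B) :
  symmetric (join_rel G H).
Proof. by move=> [a|b] [a'|b'] //=; rewrite adj_sym. Qed.

Lemma join_irrefl (A B : finType) (G : sgraph A) (H : sgraph B) :
  irreflexive (join_rel G H).
Proof. by move=> [a|b] /=; rewrite adj_irrefl. Qed.

Definition join (A B : finType) (G : sgraph A) (H : sgraph B) :
    sgraph (A + B)%type :=
  SGraph (join_sym G H) (join_irrefl G H).

(* The constant [a] in a sufficient condition of the form
   [(a + gamma) * n <= avg_color_degree] for a rainbow [F] cannot be lowered.
   For $F = K_r \vee K^l_{s-r}$ and $a = 1 - 1/(2(s-1-r))$ this holds only when
   $l + 2r \ge s$: if $l + 2r \le s - 1$, then with $t = s-1-r$ and $L$ large,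
   $F$ is a subgraph of $K_t \vee K^L_t$ (the $r$ vertices and one part of size
   $l$ lie in the $K_t$), for which $1 - 1/(2t-1) < 1 - 1/(2t)$ suffices. *)
Definition asymptotically_sharp (R : realType) (W : finType) (F : sgraph W)
    (a : R) : Prop :=
  forall eps : R, 0 < eps ->
  exists n0 : nat, forall n : nat, (n0 <= n)%N ->
  exists (V : finType) (G : sgraph V) (c : coloring V),
    [/\ #|V| = n,
        (a - eps) * n%:R <= avg_color_degree R G c
      & ~ contains_rainbow G c F].

(* $K_{\lfloor s/2\rfloor} \vee
   K^l_{\lceil s/2\rceil}$ contains $K_s$, and $K_0 \vee K^l_t$ is $K^l_t$ up to isomorphism. *)
Lemma join_contains_complete (s l : nat) : (0 < l)%N ->
  exists2 f : 'I_s -> 'I_(s./2) + 'I_(uphalf s) * 'I_l,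
    injective f &
    {homo f : u v / complete s u v
                    >-> join (complete s./2) (multipartite (uphalf s) l) u v}.
Proof.
move=> l0; have es : (s = s./2 + uphalf s)%N 
  by rewrite uphalf_half addnCA addnn odd_double_half.
pose g (x : 'I_(s./2) + 'I_(uphalf s)) : 'I_(s./2) + 'I_(uphalf s) * 'I_l :=
  match x with inl a => inl a | inr b => inr (b, Ordinal l0) end.
have g_inj : injective g by move=> [a|b] [a'|b'] //= [] ->.
have s_inj : injective (fun x : 'I_s => split (cast_ord es x)).
  by move=> x y /(can_inj (@splitK _ _)) /cast_ord_inj.
exists (fun x => g (split (cast_ord es x))) => [x y /g_inj /s_inj //|x y /=].
rewrite -(inj_eq s_inj) /=.
by case: (split (cast_ord es x)) => a; case: (split (cast_ord es y)) => b.
Qed.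

Lemma join_complete0 (t l : nat) :
  exists2 f : 'I_t * 'I_l -> 'I_0 + 'I_t * 'I_l,
    bijective f &
    {mono f : u v / multipartite t l u v
                    >-> join (complete 0) (multipartite t l) u v}.
Proof.
exists inr => //.
have inrK (x : 'I_0 + 'I_t * 'I_l) : {y | inr y = x}.
  by case: x => [[]|y] //; exists y.
exists (fun x => sval (inrK x)) => x; last by case: (inrK x).
by case: (inrK (inr x)) => y /= [].
Qed.

(* Main.v *)
Require Import Defs.
From HB Require Import structures.
From mathcomp Require Import all_boot all_order all_algebra perm.
From mathcomp Require Import reals ring lra zify.

Set Implicit Arguments.
Unset Strict Implicit.
Unset Printing Implicit Defensive.

Import Order.TTheory GRing.Theory Num.Theory.

Local Open Scope ring_scope.

(** Existence. Choose at each vertex u one edge uv of each color present at u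
    and orient it from u to v ([exists_color_orientation]). The arcs leaving a
    vertex have distinct colors, and their number is the sum of the color
    degrees, at least (1 - 1/(s-1) + gamma) n^2. Passing to a large vertex
    subset ([exists_min_degree_subset]), the sum of in- and outdegree of every
    vertex is at least (2 (1 - 1/(s-1)) + g) n.

    This degree condition forces s vertices spanning all arcs in both directions
    except for a matching of missing arcs. Indeed, given j < s vertices of this
    kind, some vertex v sends and receives at least 2 j - 1 of the 2 j possible
    arcs. If an arc between v and i is missing, then either i is unmatched and the
    new arc extends the matching, or v replaces i, which makes the matching
    smaller. To obtain not one such structure but a positive fraction of all
    s-tuples, the argument is run with uniformly random tuples ([pr_extend]).
    A positive fraction of tuples yields a positive fraction of blow-ups by
    Jensen's inequality ([pr_clone], [pr_blowup]).

    In a random blow-up, let an arc have the same color as a pair that avoids its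
    head. Since the colors at the tail are distinct, the head is determined by
    the other vertices, so this has probability at most 1/n, and a fixed number
    of such events is avoided ([pr_generic]). The only remaining coincidences
    are between edges vu and wu of which only the arcs into u are present, so
    v and w are in the same place of the pattern: the head of a missing arc.
    There are at most s/2 such places; using one vertex for each of them, and l
    vertices for the other ones, gives the rainbow graph
    ([rainbow_of_generic], [dense_digraph_rainbow]).

    The second existence statement, with t = s - 1 - r, is the first one for
    2 t + 1 instead of s, since the thresholds agree and r <= t.

    Sharpness. The first threshold is attained by the Turan graph with s - 1
    parts and all colors distinct, which has no complete graph on s vertices
    ([turan_sharp]). The second one is attained by the complete graph on t
    parts where edges between parts have distinct colors and an edge inside a
    part gets the color of its last vertex; a counting argument on the last
    vertices of a rainbow copy excludes the target when r + l > t
    ([last_color_rainbow_card]). *)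

(** * Averages over finite sets and resampling of a coordinate *)

Section Mean.
Variable R : realFieldType.

Definition mean (X : finType) (f : X -> R) : R := (\sum_x f x) / #|X|%:R.

Definition pr (X : finType) (P : pred X) : R := mean (fun x => (P x)%:R).

Section OneSpace.
Variable X : finType.
Implicit Types (f g : X -> R) (P Q : pred X).

Lemma eq_mean f g : f =1 g -> mean f = mean g.
Proof. by move=> e; rewrite /mean; under eq_bigr do rewrite e. Qed.

Lemma le_mean f g : (forall x, f x <= g x) -> mean f <= mean g.
Proof. by move=> h; rewrite ler_wpM2r ?invr_ge0 ?ler0n// ler_sum. Qed.

Lemma mean_sum (I : finType) (Q : pred I) (F : I -> X -> R) :
  mean (fun x => \sum_(i | Q i) F i x) = \sum_(i | Q i) mean (F i).
Proof. by rewrite /mean exchange_big mulr_suml. Qed.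

Lemma meanMl a f : mean (fun x => a * f x) = a * mean f.
Proof. by rewrite /mean -mulr_sumr mulrA. Qed.

Lemma meanD f g : mean (fun x => f x + g x) = mean f + mean g.
Proof. by rewrite /mean big_split mulrDl. Qed.

Hypothesis X_gt0 : (0 < #|X|)%N.

Lemma mean_const a : mean (fun _ : X => a) = a.
Proof.
by rewrite /mean sumr_const -[a *+ _]mulr_natr mulfK// pnatr_eq0 -lt0n.
Qed.

(** Jensen's inequality, from the tangent line of the square at the mean. *)
Lemma sqr_mean f : mean f ^+ 2 <= mean (fun x => f x ^+ 2).
Proof.
set t := mean f.
have -> : t ^+ 2 = mean (fun x => 2 * t * f x + - t ^+ 2).
  by rewrite meanD mean_const meanMl -/t; ring.
by apply: le_mean => x; have := sqr_ge0 (f x - t); nra.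
Qed.

End OneSpace.

Lemma pr_mono (X : finType) (P Q : pred X) : subpred P Q -> pr P <= pr Q.
Proof.
move=> PQ; apply: le_mean => x; have := PQ x.
by case: (P x) => [->//|_]; rewrite ler0n.
Qed.

(** The union bound. *)
Lemma pr_has (X I : finType) (E : I -> pred X) :
  pr (fun x => [exists i, E i x]) <= \sum_i pr (E i).
Proof.
rewrite -mean_sum; apply: le_mean => x.
case: existsP => [[i Ei]|_]; last by apply: sumr_ge0 => i _; rewrite ler0n.
by rewrite (bigD1 i)//= Ei lerDl; apply: sumr_ge0 => j _; rewrite ler0n.
Qed.

Lemma pr_reindex (X : finType) (h : X -> X) (P : pred X) :
  bijective h -> pr (fun x => P (h x)) = pr P.
Proof.
move=> [h' hK h'K]; rewrite /pr /mean; congr (_ / _).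
by rewrite [RHS](reindex h)//; exists h' => x _.
Qed.

Section Resampling.
Variables J T : finType.
Hypothesis T_gt0 : (0 < #|T|)%N.
Local Notation Om := {ffun J -> T}.
Implicit Types (z : Om) (x : J) (v : T).

Definition upd z x v : Om := [ffun y => if y == x then v else z y].

Lemma updE z x v y : upd z x v y = if y == x then v else z y.
Proof. by rewrite ffunE. Qed.

Lemma card_Om_gt0 : (0 < #|{: Om}|)%N.
Proof. by rewrite card_ffun expn_gt0 T_gt0. Qed.

(** The pair (old point with a fresh value at x, old value at x) is an
    involution of the product space, hence resampling preserves the mean. *)
Lemma mean_resample x (f : Om -> R) :
  mean (fun z => mean (fun v => f (upd z x v))) = mean f.
Proof.
pose h (p : Om * T) : Om * T := (upd p.1 x p.2, p.1 x).
have hK : involutive h.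
  move=> [z v]; congr pair; rewrite /= ?updE ?eqxx//.
  by apply/ffunP => y; rewrite !updE; case: eqP => [->|].
have sum_upd : \sum_z \sum_v f (upd z x v) = (\sum_z f z) * #|T|%:R.
  rewrite pair_big /= (eq_bigr (fun p => f (h p).1))//.
  rewrite -(reindex_inj (inv_inj hK) (P := xpredT) (F := fun p => f p.1)) /=.
  rewrite -(pair_big xpredT xpredT (fun z (_ : T) => f z)) /= mulr_suml.
  by apply: eq_bigr => z _; rewrite sumr_const mulr_natr.
rewrite /mean -mulr_suml sum_upd mulfK// pnatr_eq0 -lt0n//.
Qed.

Lemma pr_resample x (P : pred Om) :
  mean (fun z => pr (fun v => P (upd z x v))) = pr P.
Proof. exact: mean_resample. Qed.

(** If the other coordinates determine the value at x, an event costs a factor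
    of the size of the alphabet. *)
Lemma pr_determined x (P : pred Om) :
  (forall z v v', P (upd z x v) -> P (upd z x v') -> v = v') ->
  pr P <= #|T|%:R^-1.
Proof.
move=> det; rewrite -(pr_resample x) -[leRHS](mean_const card_Om_gt0).
apply: le_mean => z; rewrite -[leRHS]mul1r ler_wpM2r ?invr_ge0 ?ler0n//.
rewrite -natr_sum -big_mkcond sum1_card /= (ler_nat _ _ 1).
by apply/card_le1_eqP => v v' /= Pv Pv'; apply: (det z).
Qed.

End Resampling.
End Mean.

(** * Patterns of arcs and their extension by one vertex *)

Section Patterns.
Variables (J T : finType) (D : rel T).
Local Notation Om := {ffun J -> T}.
Implicit Types (P Q : rel J) (A : {set J}) (M : {set J * J}) (z : Om).

Definition follows P A : pred Om :=
  fun z => [forall u in A, forall v in A, P u v ==> D (z u) (z v)].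

Lemma followsP P A z :
  reflect (forall u v, u \in A -> v \in A -> P u v -> D (z u) (z v))
          (follows P A z).
Proof.
apply: (iffP forall_inP) => [h u v uA vA Puv|h u uA].
  by have /forall_inP/(_ v vA)/implyP/(_ Puv) := h u uA.
by apply/forall_inP => v vA; apply/implyP; apply: h.
Qed.

Lemma follows_setU1 P A x z : ~~ P x x -> follows P A z ->
    {in A, forall u, (P x u -> D (z x) (z u)) /\ (P u x -> D (z u) (z x))} ->
  follows P (x |: A) z.
Proof.
move=> /negPf Pxx /followsP zA zx; apply/followsP => u v; rewrite !in_setU1.
move=> /orP[/eqP->|uA] /orP[/eqP->|vA]; first by rewrite Pxx.
- by have [] := zx v vA.
- by have [] := zx u uA.
- exact: zA.
Qed.

(** The pattern of a complete digraph from which the arcs of M may be absent. *)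
Definition off M : rel J := fun u v => (u != v) && ((u, v) \notin M).

Definition meets (e f : J * J) : bool :=
  [|| e.1 == f.1, e.1 == f.2, e.2 == f.1 | e.2 == f.2].

(** Pairwise disjoint arcs on A. Two points of A are thus joined by at least one
    arc of [off M], and at each point at most one arc is missing. *)
Definition matching A M : Prop :=
  {in M, forall e, [/\ e.1 \in A, e.2 \in A & e.1 != e.2]} /\
  {in M &, forall e f, meets e f -> e = f}.

Definition weight (x y : T) : nat := D x y + D y x.

Lemma weight_le2 x y : (weight x y <= 2)%N.
Proof. by rewrite /weight; case: (D x y); case: (D y x). Qed.

Lemma sum_weight_le A z v : (\sum_(i in A) weight v (z i) <= 2 * #|A|)%N.
Proof.
apply: (@leq_trans (\sum_(i in A) 2)); last by rewrite sum_nat_const mulnC.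
by apply: leq_sum => i _; apply: weight_le2.
Qed.

Definition nearly_joined A z v : bool :=
  (2 * #|A| <= (\sum_(i in A) weight v (z i)).+1)%N.

(** Weights are at most two, so a total that is at most one short leaves a
    single place where one arc can be lacking. *)
Lemma nearly_joinedP A z v : nearly_joined A z v ->
  {in A, forall i, weight v (z i) = 2} \/
  exists2 i, i \in A & weight v (z i) = 1 /\
    {in A, forall j, j != i -> weight v (z j) = 2}.
Proof.
rewrite /nearly_joined => near.
have [/forall_inP h|] := boolP [forall i in A, weight v (z i) == 2].
  by left=> i iA; apply/eqP/h.
rewrite negb_forall_in => /exists_inP[i iA wi]; right; exists i => //.
have hB B := sum_weight_le B z v.
have hi := weight_le2 v (z i).
have split1 (B : {set J}) j : j \in B ->
    (\sum_(k in B) weight v (z k) = weight v (z j) +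
     \sum_(k in B :\ j) weight v (z k))%N /\ #|B| = #|B :\ j|.+1.
  by move=> jB; rewrite (big_setD1 j)//= (cardsD1 j) jB.
have [e1 c1] := split1 A i iA.
have hAi := hB (A :\ i).
split; first by move/eqP: wi; lia.
move=> j jA ji; have jAi : j \in A :\ i by rewrite !inE ji.
have [e2 c2] := split1 _ _ jAi.
have := hB (A :\ i :\ j); have := weight_le2 v (z j); move/eqP: wi; lia.
Qed.

Section Extension.
Variables (R : realFieldType) (p : nat) (g : R).
Hypotheses (T_gt0 : (0 < #|T|)%N) (p_gt0 : (0 < p)%N) (g_ge0 : 0 <= g)
  (g_le2 : g <= 2).
Hypothesis min_degree :
  forall x : T, 2 * (1 - 1 / p%:R) + g <= mean (fun v => (weight v x)%:R).

(** The weights from a random vertex to the points of A add up to more than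
    two less than the maximum on average, since the size of A is at most p. *)
Lemma pr_nearly_joined A z : (#|A| <= p)%N ->
  g / 2 <= pr R (nearly_joined A z).
Proof.
move=> Ap; have [A0|A_gt0] := posnP #|A|.
  suff -> : pr R (nearly_joined A z) = 1 by rewrite ler_pdivrMr ?mul1r ?ltr0n.
  rewrite -[RHS](mean_const T_gt0); apply: eq_mean => v.
  by rewrite /nearly_joined A0 muln0.
pose a : R := #|A|%:R.
have a1 : 1 <= a by rewrite /a ler1n.
have pp : 0 < p%:R :> R by rewrite ltr0n.
have ap : a / p%:R <= 1 by rewrite ler_pdivrMr// mul1r ler_nat.
have lo : a * (2 * (1 - 1 / p%:R) + g) <=
    mean (fun v => \sum_(i in A) (weight v (z i))%:R).
  by rewrite mean_sum /a mulr_natl -sumr_const ler_sum.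
have hi : mean (fun v => \sum_(i in A) (weight v (z i))%:R) <=
    2 * pr R (nearly_joined A z) + (2 * a - 2).
  rewrite -{1}(mean_const T_gt0 (2 * a - 2)) -meanMl -meanD.
  apply: le_mean => v; rewrite -natr_sum /nearly_joined.
  set S := (\sum_(i in A) _)%N.
  have S2 : (S <= 2 * #|A|)%N by apply: sum_weight_le.
  have eA : 2 * a = (2 * #|A|)%:R by rewrite natrM.
  rewrite eA; case: leqP => h.
    by rewrite mulr1 addrC subrK ler_nat.
  by rewrite mulr0 add0r lerBrDr -natrD ler_nat; lia.
have ag : g <= a * g by rewrite ler_peMl.
have {lo hi} := le_trans lo hi; rewrite div1r mulrDr mulrCA mulrBr mulr1 => lohi.
by rewrite ler_pdivrMr//; move: ap ag lohi; set q := pr _ _; clearbody a q; lra.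
Qed.

Variable kappa : R.
Hypotheses (kappa_gt0 : 0 < kappa) (kappa_le1 : kappa <= 1)
  (kappa_small : kappa * (2 * #|J|%:R + 1) <= g / 2).

Lemma matching_setU1 A M x : matching A M -> matching (x |: A) M.
Proof.
move=> [inA disj]; split=> // e /inA [e1 e2 e12].
by rewrite !in_setU1 e1 e2 !orbT.
Qed.

Lemma matching_sub A M M' : M' \subset M -> matching A M -> matching A M'.
Proof.
move=> /subsetP sub [inA disj]; split=> [e /sub|e f /sub eM /sub].
  exact: inA.
exact: disj.
Qed.

(** One new missing arc, given as an ordered pair with ends x and i. *)
Lemma matching_add A M x i e0 : x \notin A -> i \in A -> matching A M ->
    (e0 == (x, i)) || (e0 == (i, x)) ->
    {in M, forall e, (e.1 != i) && (e.2 != i)} ->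
  matching (x |: A) (e0 |: M).
Proof.
move=> xA iA [inA disj] he0 free.
have nx y : y \in A -> x != y by apply: contraTneq => <-.
have ne0 e : e \in M -> ~~ meets e0 e && ~~ meets e e0.
  move=> eM; have [/nx h1 /nx h2 _] := inA e eM; have /andP[h3 h4] := free e eM.
  rewrite /meets.
  by case/orP: he0 => /eqP -> /=;
    rewrite !(eq_sym i) !(eq_sym _ x) (negPf h1) (negPf h2)
      (negPf h3) (negPf h4).
split=> [e|e f]; rewrite !in_setU1.
  case/orP => [/eqP ->|/inA [e1 e2 e12]]; last by rewrite e1 e2 !orbT.
  by case/orP: he0 => /eqP -> /=; rewrite eqxx iA !orbT; split=> //;
    rewrite ?nx// eq_sym nx.
case/orP => [/eqP->|eM] /orP[/eqP->|fM] //.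
- by case/andP: (ne0 f fM) => /negPf->.
- by case/andP: (ne0 e eM) => _ /negPf->.
- exact: disj.
Qed.

(** A random vertex put at x is nearly joined to a random copy of the pattern
    with probability at least g / 2. If no arc is lacking, x extends the pattern. If
    one arc is lacking, between x and i, then it joins the matching when i is
    unmatched. When i is matched, x takes the place of i: x is fully joined to
    the rest of A, so the missing arc at i disappears and the matching shrinks.
    One of these 2 #|J| + 1 outcomes keeps its share of the probability. *)
Lemma pr_extend_or_swap A M x (eps : R) : (#|A| <= p)%N -> x \notin A ->
    matching A M -> 0 < eps -> eps <= pr R (follows (off M) A) ->
  (exists2 M', matching (x |: A) M' &
     kappa * eps <= pr R (follows (off M') (x |: A))) \/
  (exists M', [/\ matching A M', (#|M'| < #|M|)%N &
     kappa * eps <= pr R (follows (off M') A)]).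
Proof.
move=> Ap xA mA eps_gt0 prA.
have upd_in z v u : u \in A -> upd z x v u = z u.
  by move=> uA; rewrite updE ifN//; apply: contraNneq xA => <-.
pose E z := follows (off M) A z && nearly_joined A z (z x).
have prE : (g / 2) * eps <= pr R E.
  rewrite -(pr_resample R T_gt0 x).
  apply: (@le_trans _ _ ((g / 2) * pr R (follows (off M) A))).
    by rewrite ler_wpM2l// divr_ge0.
  rewrite -meanMl; apply: le_mean => z.
  have -> : pr R (fun v => E (upd z x v)) =
      mean (fun v => (follows (off M) A z)%:R * (nearly_joined A z v)%:R).
    apply: eq_mean => v; rewrite /E -natrM mulnb; congr (_ && _)%:R.
      by apply/followsP/followsP => h u w uA wA /(h u w uA wA); rewrite !upd_in.
    rewrite /nearly_joined updE eqxx; congr (_ <= _.+1)%N.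
    by apply: eq_bigr => i iA; rewrite upd_in.
  by rewrite meanMl mulrC ler_wpM2l// pr_nearly_joined.
pose lack (t : option (J * bool)) : {set J * J} :=
  if t is Some (i, b) then (if b then (x, i) else (i, x)) |: M else M.
pose valid (t : option (J * bool)) := if t is Some (i, _) then i \in A else true.
pose F t z := valid t && follows (off (lack t)) (x |: A) z.
have nx y : y \in A -> x != y by apply: contraTneq => <-.
(* The boolean in Some (i, b) tells which of the two arcs is lacking. *)
have cover : subpred E (fun z => [exists t, F t z]).
  move=> z /andP[zA near]; apply/existsP.
  have both v : weight (z x) (z v) = 2 -> D (z x) (z v) /\ D (z v) (z x).
    by rewrite /weight; case: (D _ _); case: (D _ _).
  have offxx M0 : ~~ off M0 x x by rewrite /off eqxx.
  case: (nearly_joinedP near) => [full|[i iA [wi full]]].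
    by exists None; apply: follows_setU1 => // u /full/both[].
  exists (Some (i, D (z i) (z x))); rewrite /F /= iA /=.
  apply: follows_setU1 => // [|u uA].
    move/followsP: zA => zA; apply/followsP => u v uA vA; rewrite /off.
    case/andP=> uv; rewrite in_setU1 => /norP[_ ?]; apply: zA => //.
    exact/andP.
  have [->|/(full u uA)/both[]//] := eqVneq u i.
  move: wi; rewrite /weight /off !in_setU1.
  case: (D (z x) (z i)); case: (D (z i) (z x)) => //= _; split=> //.
    by rewrite eqxx andbF.
  by rewrite eqxx andbF.
have [t big_t] : exists t, kappa * eps <= pr R (F t).
  apply/existsP; rewrite -[[exists _, _]]negbK negb_exists; apply/negP.
  move=> /forallP small.
  have := le_trans (pr_mono R cover) (pr_has R F).
  apply/negP; rewrite -ltNge; apply: lt_le_trans prE.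
  apply: (@lt_le_trans _ _ (\sum_(t : option (J * bool)) kappa * eps)).
    apply: ltr_sum => [|t _]; last by rewrite ltNge small.
    by apply/hasP; exists None; rewrite // mem_index_enum.
  rewrite sumr_const card_option card_prod card_bool -[_ *+ _.+1]mulr_natr.
  rewrite -natr1 natrM (mulrC _ 2) mulrAC; apply: ler_wpM2r => //.
  exact: ltW.
have t_valid : valid t.
  apply: contraT => /negPf nv; move: big_t; rewrite leNgt (_ : pr R (F t) = 0).
    by rewrite mulr_gt0.
  rewrite /pr (eq_mean (g := fun=> 0)) ?mean_const ?card_Om_gt0// => z.
  by rewrite /F nv.
case: t big_t t_valid => [[i b]|] big_t; last first.
  by left; exists M => //; apply: matching_setU1.
move=> /= iA; pose e0 := if b then (x, i) else (i, x).
have prF : kappa * eps <= pr R (follows (off (e0 |: M)) (x |: A)).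
  by apply: le_trans big_t _; apply: pr_mono => z /andP[].
have [/forall_inP free|] :=
    boolP [forall e in M, (e.1 != i) && (e.2 != i)].
  left; exists (e0 |: M) => //; apply: matching_add iA mA _ free => //.
  by rewrite /e0; case: (b); rewrite eqxx ?orbT.
rewrite negb_forall_in => /exists_inP[e eM ei]; right.
pose M' := [set f in M | (f.1 != i) && (f.2 != i)].
have M'M : M' \subset M by apply/subsetP => f; rewrite inE => /andP[].
exists M'; split; first exact: matching_sub mA.
  apply: proper_card; rewrite properEneq M'M andbT.
  by apply: contraTneq eM => <-; rewrite inE (negPf ei) andbF.
apply: le_trans prF _.
(* Exchanging the values at i and x is a bijection of the sample space. *)
pose sw z : Om := [ffun u => z (tperm i x u)].
have sw_inv : involutive sw by move=> z; apply/ffunP => u; rewrite !ffunE tpermK.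
rewrite -[leRHS](pr_reindex R _ (inv_bij sw_inv)).
apply: pr_mono => z /followsP zA; apply/followsP => u v uA vA /andP[uv uvM'].
rewrite !ffunE; have inA := mA.1.
have xM y : ((x, y) \notin M) && ((y, x) \notin M).
  by apply/andP; split; apply: contraNN xA => /inA[].
have [xMl xMr] : (forall y, ((x, y) \in M) = false) /\
    (forall y, ((y, x) \in M) = false).
  by split=> y; have /andP[/negPf h1 /negPf h2] := xM y.
have ne_x y : y \in A -> (y == x) = false.
  by move=> /nx; rewrite eq_sym => /negPf.
have e0x y : y \in A -> y != i ->
    ((x, y) \notin e0 |: M) && ((y, x) \notin e0 |: M).
  move=> yA /negPf yi; rewrite !in_setU1 xMl xMr !orbF /e0.
  by case: (b); rewrite !xpair_eqE ?yi ?andbF ?(ne_x y yA) ?andbF.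
have [ui|ui] := eqVneq u i; have [vi|vi] := eqVneq v i.
- by rewrite ui vi eqxx in uv.
- subst u; rewrite tpermL tpermD ?nx// 1?eq_sym//.
  apply: zA; rewrite ?setU11 ?in_setU1 ?vA ?orbT// /off nx//=.
  by case/andP: (e0x v vA vi).
- subst v; rewrite tpermL tpermD ?nx// 1?eq_sym//.
  apply: zA; rewrite ?setU11 ?in_setU1 ?uA ?orbT// /off ne_x//=.
  by case/andP: (e0x u uA ui).
- rewrite !tpermD ?nx// 1?eq_sym//.
  apply: zA; rewrite ?in_setU1 ?uA ?vA ?orbT// /off uv /=.
  rewrite in_setU1 negb_or; apply/andP; split; last first.
    by apply: contraNN uvM' => h; rewrite inE h ui vi.
  by rewrite /e0; case: (b); rewrite xpair_eqE ?(negPf ui) ?(negPf vi) ?andbF.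
Qed.

(** Swaps only shrink the matching, so after boundedly many of them the
    structure is extended. *)
Lemma pr_extend A M x eps : (#|A| <= p)%N -> x \notin A ->
    matching A M -> 0 < eps -> eps <= pr R (follows (off M) A) ->
  exists2 M', matching (x |: A) M' &
    kappa ^+ #|{: J * J}|.+1 * eps <= pr R (follows (off M') (x |: A)).
Proof.
move=> Ap xA mA eps_gt0 prA.
have : (#|M| < #|{: J * J}|.+1)%N by rewrite ltnS max_card.
elim: _.+1 M eps mA eps_gt0 prA => // k IH M eps mA eps_gt0 prA.
rewrite ltnS => Mk.
have [[M' mM' prM']|[M' [mM' M'M prM']]] :=
  pr_extend_or_swap Ap xA mA eps_gt0 prA.
  exists M' => //; apply: le_trans prM'.
  apply: ler_wpM2r; first exact: ltW.
  by rewrite exprS ler_piMr ?(ltW kappa_gt0)// exprn_ile1// ltW.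
have [M'' mM'' prM''] :=
  IH M' _ mM' (mulr_gt0 kappa_gt0 eps_gt0) prM' (leq_trans M'M Mk).
by exists M'' => //; rewrite exprSr -mulrA.
Qed.



End Extension.
End Patterns.

(** * Blow-ups of patterns *)

Section Blowup.
Variables (R : realFieldType) (J T : finType) (D : rel T).
Hypothesis T_gt0 : (0 < #|T|)%N.
Local Notation Om := {ffun J -> T}.
Implicit Types (P : rel J) (A : {set J}) (z : Om).

(** The vertices are added one by one, each at the cost of a factor that does
    not depend on T. *)
Lemma pr_structure (p : nat) (g kappa : R) A : (0 < p)%N -> 0 <= g -> g <= 2 ->
    (forall x : T, 2 * (1 - 1 / p%:R) + g <=
       mean (fun v => (weight D v x)%:R)) ->
    0 < kappa -> kappa <= 1 -> kappa * (2 * #|J|%:R + 1) <= g / 2 ->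
    (#|A| <= p.+1)%N ->
  exists2 M, matching A M &
    (kappa ^+ #|{: J * J}|.+1) ^+ #|A| <= pr R (follows D (off M) A).
Proof.
move=> p_gt0 g_ge0 g_le2 mindeg k_gt0 k_le1 k_small.
set beta := kappa ^+ _.+1; have b_gt0 : 0 < beta by rewrite exprn_gt0.
move cA: #|A| => m; elim: m A cA => [|m IH] A cA Ap.
  exists set0; first by split=> e; rewrite inE.
  rewrite expr0 -[leLHS](mean_const (card_Om_gt0 J T_gt0)).
  apply: le_mean => z; suff -> : follows D (off set0) A z by [].
  by apply/followsP => u v; move/cards0_eq: cA => ->; rewrite inE.
have [x xA] : exists x, x \in A by apply/card_gt0P; rewrite cA.
have cAx : #|A :\ x| = m by move: cA; rewrite (cardsD1 x) xA => -[].
have [M mM prM] := IH _ cAx (ltnW Ap).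
have Axp : (#|A :\ x| <= p)%N by rewrite cAx.
have xAx : x \notin A :\ x by rewrite setD11.
have [M' mM' prM'] := pr_extend T_gt0 p_gt0 g_ge0 g_le2 mindeg k_gt0 k_le1
  k_small Axp xAx mM (exprn_gt0 m b_gt0) prM.
by move: mM' prM'; rewrite setD1K// => mM' prM'; exists M' => //; rewrite exprS.
Qed.

(** Given the other coordinates, the values at x and at i are two independent
    samples of the same condition; Jensen's inequality bounds the probability
    that both satisfy it. *)
Lemma pr_clone P A i x : i \in A -> x \notin A ->
    (forall v, P x v = P i v) -> (forall v, P v x = P v i) -> ~~ P i i ->
  pr R (follows D P A) ^+ 2 <= pr R (follows D P (x |: A)).
Proof.
move=> iA xA Px P'x /negPf Pii.
pose d z : R := pr R (fun v => follows D P A (upd z i v)).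
rewrite -(pr_resample R T_gt0 i).
apply: le_trans (sqr_mean (card_Om_gt0 J T_gt0) d) _.
rewrite -[leRHS](pr_resample R T_gt0 i) -[leRHS](mean_resample T_gt0 x).
apply: le_mean => z; rewrite expr2 -/(d z) {1}/d {1}/pr mulrC -meanMl.
apply: le_mean => v'; case zv': (follows D P A (upd z i v')); last first.
  by rewrite mulr0 -(mean_const T_gt0 0); apply: le_mean => v; rewrite ler0n.
rewrite mulr1; apply: pr_mono => v zv.
have xi : (x == i) = false by apply/negbTE; apply: contraNneq xA => ->.
have ix : (i == x) = false by rewrite eq_sym.
have nx u : u \in A -> (u == x) = false.
  by move=> uA; apply/negbTE; apply: contraNneq xA => <-.
move/followsP: zv => zv; move/followsP: zv' => zv'.
have Pxx : P x x = false by rewrite Px P'x.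
apply: follows_setU1; rewrite ?Pxx//.
  apply/followsP => u w uA wA Puw; have := zv u w uA wA Puw.
  by rewrite !updE (nx u)// (nx w).
move=> u uA; have := zv' i u iA uA; have := zv' u i uA iA.
rewrite Px P'x !updE xi !eqxx (nx u)//.
by have [->|] := eqVneq u i; first rewrite Pii.
Qed.

(** Starting from A0, each point x of A outside A0 is added as a clone of its
    image under pi, which squares the bound. *)
Lemma pr_blowup (pi : J -> J) P A0 A (eps : R) : irreflexive P ->
    {in A0, forall j, pi j = j} -> (forall j, pi j \in A0) -> A0 \subset A ->
    0 <= eps -> eps <= pr R (follows D P A0) ->
  eps ^+ (2 ^ #|A :\: A0|) <= pr R (follows D (relpre pi P) A).
Proof.
move=> Pirr piA0 pi_in A0A eps_ge0 prP.
move cA: #|A :\: A0| => m; elim: m A A0A cA => [|m IH] A A0A cA.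
  have -> : A = A0.
    by apply/eqP; rewrite eqEsubset A0A andbT -setD_eq0 -cards_eq0 cA.
  rewrite expr1; apply: le_trans prP _; apply: pr_mono => z /followsP zA.
  by apply/followsP => u v uA vA /=; rewrite !piA0//; apply: zA.
have [x] : exists x, x \in A :\: A0 by apply/card_gt0P; rewrite cA.
rewrite inE => /andP[xA0 xA].
have A0Ax : A0 \subset A :\ x by rewrite subsetD1 A0A.
have cAx : #|(A :\ x) :\: A0| = m.
  move: cA; rewrite (cardsD1 x) inE xA0 xA => -[<-]; apply: eq_card => y.
  by rewrite !inE; case: (y == x); rewrite ?andbF.
have pix : pi (pi x) = pi x by apply: piA0.
rewrite -(setD1K xA); apply: le_trans (pr_clone (i := pi x) _ _ _ _ _).
- rewrite expnSr exprM lerXn2r ?nnegrE ?exprn_ge0//; last exact: IH.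
  by apply: le_trans (IH _ A0Ax cAx); rewrite exprn_ge0.
- exact: (subsetP A0Ax).
- by rewrite setD11.
- by move=> v /=; rewrite pix.
- by move=> v /=; rewrite pix.
- by rewrite /= pix Pirr.
Qed.

End Blowup.

(** * Rainbow subgraphs from generic blow-ups *)

Section Rainbow.
Variables (T : finType) (D : rel T) (col : T -> T -> nat).
Hypotheses (colC : forall a b, col a b = col b a)
  (out_inj : forall a b b', D a b -> D a b' -> col a b = col a b' -> b = b').

(** Equal colors on the arc t.1 and the pair t.2, when the head of the arc is
    not in the pair: the head is then determined by the three other vertices,
    which makes the event rare. *)
Definition collision (J : finType) (z : {ffun J -> T})
    (t : (J * J) * (J * J)) : bool :=
  [&& t.1.2 != t.1.1, t.1.2 != t.2.1, t.1.2 != t.2.2,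
      D (z t.1.1) (z t.1.2) &
      col (z t.1.1) (z t.1.2) == col (z t.2.1) (z t.2.2)].

(** Each coincidence has probability at most 1 / #|T|, and there are boundedly
    many of them. *)
Lemma pr_generic (R : realFieldType) (J : finType) (E : pred {ffun J -> T})
    (delta : R) :
    (0 < #|T|)%N -> delta <= pr R E ->
    (#|J| ^ 2 + #|J| ^ 4)%N%:R / #|T|%:R < delta ->
  exists z, [/\ E z, injective z & forall t, ~~ collision z t].
Proof.
move=> T_gt0 prE small.
pose I := ((J * J) + (J * J) * (J * J))%type.
pose B (i : I) : pred {ffun J -> T} := fun z =>
  match i with
  | inl xy => (xy.1 != xy.2) && (z xy.1 == z xy.2)
  | inr t => collision z t
  end.
have prB i : pr R (B i) <= #|T|%:R^-1.
  case: i => [[x y]|[[u v] [x y]]].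
    apply: (pr_determined R T_gt0 (x := x)) => // z v v' /=.
    rewrite !updE eqxx; case: (eqVneq y x) => [//|_].
    by move=> /andP[_ /eqP->] /andP[_ /eqP->].
  apply: (pr_determined R T_gt0 (x := v)) => // z a a'.
  rewrite /B /collision /=.
  case/and5P => /negPf vu /negPf vx /negPf vy.
  rewrite !updE eqxx ![_ == v]eq_sym vu vx vy => Da /eqP ca.
  by case/and5P => _ _ _ Da' /eqP ca'; apply: out_inj Da Da' _; rewrite ca ca'.
have [/existsP[z /andP[Ez /existsPn zB]]|/existsPn all_bad] :=
    boolP [exists z, E z && ~~ [exists i, B i z]].
  exists z; split=> // [x y zxy|t]; last exact: (zB (inr t)).
  by apply/eqP; apply: contraNT (zB (inl (x, y))) => xy; rewrite /= xy zxy eqxx.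
move: small; rewrite ltNge => /negP[]; apply: le_trans prE _.
apply: (@le_trans _ _ (pr R (fun z => [exists i, B i z]))).
  by apply: pr_mono => z Ez; have := all_bad z; rewrite Ez negbK.
apply: le_trans (pr_has R B) _.
apply: (@le_trans _ _ (\sum_(i : I) #|T|%:R^-1)); first exact: ler_sum.
rewrite sumr_const card_sum !card_prod -[_ *+ (_ + _)]mulr_natl.
by rewrite (_ : _ + _ = #|J| ^ 2 + #|J| ^ 4)%N//; lia.
Qed.

(** Let uv and xy be distinct edges of the same color, v not in xy and y not in
    uv. As there are no collisions, the arcs from u to v and from x to y are
    missing. If u is not in xy, the same applies to the arc from v to u, but
    both arcs cannot be missing. Otherwise u = x, so v and y have the same place
    in the pattern, namely the head of the missing arc at u; as this place is
    taken only once, v = y. *)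
Lemma rainbow_of_generic (J : finType) (A : {set J}) (M : {set J * J})
    (pi : J -> J) (z : {ffun J -> T}) (W : finType) (F : sgraph W) (g : W -> J) :
    matching A M -> follows D (relpre pi (off M)) setT z ->
    injective z -> (forall t, ~~ collision z t) -> injective g ->
    (forall u v, F u v -> pi (g u) != pi (g v)) ->
    (forall e u v, e \in M -> pi (g u) = e.2 -> pi (g v) = e.2 -> u = v) ->
  let f w := z (g w) in
  [/\ injective f,
      forall u v, F u v -> D (f u) (f v) || D (f v) (f u)
    & forall u v x y, F u v -> F x y -> col (f u) (f v) = col (f x) (f y) ->
      [set u; v] = [set x; y]].
Proof.
move=> mM /followsP zP z_inj no_coll g_inj Fpi single f.
have f_inj : injective f by move=> u v /z_inj/g_inj.
have Fne u v : F u v -> u != v by move/Fpi; apply: contraNneq => ->.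
have arc u v : F u v -> (pi (g u), pi (g v)) \notin M -> D (f u) (f v).
  by move=> uv uvM; apply: zP; rewrite ?inE//= /off Fpi.
have one_missing u v : F u v -> (pi (g u), pi (g v)) \in M ->
    (pi (g v), pi (g u)) \notin M.
  move=> uv uvM; apply/negP => vuM.
  have := mM.2 _ _ uvM vuM; rewrite /meets /= eqxx !orbT => /(_ isT) [e _].
  by have := Fpi u v uv; rewrite e eqxx.
split=> // [u v uv|].
  have [uvM|/(arc u v uv)->//] := boolP ((pi (g u), pi (g v)) \in M).
  by rewrite orbC (arc v u) 1?adj_sym// one_missing.
have missing u v x y : F u v -> F x y -> col (f u) (f v) = col (f x) (f y) ->
    v \notin [set x; y] -> (pi (g u), pi (g v)) \in M.
  move=> uv xy cc vxy; apply: contraT => /(arc u v uv) Duv.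
  case/negP: (no_coll ((g u, g v), (g x, g y))).
  rewrite /collision /= -!/(f _) Duv cc eqxx !(inj_eq g_inj) eq_sym Fne//.
  by move: vxy; rewrite !inE negb_or => /andP[-> ->].
have inside u v x y : F u v -> F x y -> col (f u) (f v) = col (f x) (f y) ->
    v \in [set x; y].
  move=> uv xy cc; apply: contraT => vxy.
  have uvM := missing u v x y uv xy cc vxy.
  have : u \in [set x; y].
    apply: contraT => uxy; case/negP: (one_missing _ _ uv uvM).
    by apply: (missing v u x y) uxy => //; [rewrite adj_sym | rewrite colC].
  have shared y' : F u y' -> col (f u) (f v) = col (f u) (f y') -> v = y'.
    move=> uy cc'; apply/eqP; apply: contraT => vy.
    have uyM : (pi (g u), pi (g y')) \in M.
      apply: (missing u y' u v) => //; rewrite !inE negb_or eq_sym Fne//=.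
      by rewrite eq_sym.
    have := mM.2 _ _ uvM uyM; rewrite /meets /= eqxx => /(_ isT) [e].
    by have := single _ v y' uvM erefl (esym e) => /eqP; rewrite (negPf vy).
  rewrite !inE => /orP[/eqP ux|/eqP uy].
    by rewrite -ux in xy cc *; rewrite (shared y) ?set22// in vxy.
  rewrite -uy in xy cc; rewrite adj_sym in xy; rewrite (colC (f x)) in cc.
  by rewrite (shared x) ?set21// in vxy.
move=> u v x y uv xy cc; apply/eqP; rewrite eqEcard.
rewrite !cards2 !Fne// leqnn andbT; apply/subsetP => w; rewrite in_set2.
case/orP => /eqP->; last exact: inside uv xy cc.
by apply: (inside v u x y) => //; [rewrite adj_sym | rewrite colC].
Qed.

End Rainbow.

(** Used to place the heads of missing arcs among the first parts. *)
Lemma exists_enumeration_from (s : nat) (H : {set 'I_s.+1}) :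
  exists sg : nat -> 'I_s.+1,
    {in gtn s.+1 &, injective sg} /\
    (forall i, (i < s.+1)%N -> sg i \in H -> (i < #|H|)%N).
Proof.
pose t := enum H ++ enum (~: H).
have st : size t = s.+1 by rewrite size_cat -!cardE cardsC card_ord.
have ut : uniq t.
  rewrite cat_uniq !enum_uniq andbT /=; apply/hasPn => x.
  by rewrite !mem_enum inE.
exists (nth ord0 t); split=> [i j|i is1].
  by rewrite !inE => it jt /eqP; rewrite nth_uniq ?st// => /eqP.
rewrite nth_cat -cardE; case: ltnP => // Hi iH.
have : nth ord0 (enum (~: H)) (i - #|H|) \in enum (~: H).
  by rewrite mem_nth// -cardE ltn_subLR// cardsC card_ord.
by rewrite mem_enum inE iH.
Qed.

Lemma card_matching_heads (J : finType) (A : {set J}) M : matching A M ->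
  (#|[set e.2 | e in M]|.*2 <= #|A|)%N.
Proof.
move=> [inA disj].
have c2 : (#|[set e.2 | e in M]| = #|M|)%N.
  apply: card_in_imset => e f eM fM ef; apply: disj => //.
  by rewrite /meets ef eqxx !orbT.
have c1 : (#|[set e.1 | e in M]| = #|M|)%N.
  apply: card_in_imset => e f eM fM ef; apply: disj => //.
  by rewrite /meets ef eqxx.
rewrite -addnn {1}c2 -c1 -cardsUI.
rewrite (_ : _ :&: _ = set0) ?cards0 ?addn0.
  apply: subset_leq_card; apply/subsetP => x; rewrite inE.
  by case/orP => /imsetP[e /inA [e1 e2 _] ->].
apply/setP => x; rewrite !inE; apply/negP => /andP[/imsetP[e eM ->] /imsetP[f fM]].
move=> ef; have ee : e = f by apply: disj; rewrite // /meets ef eqxx ?orbT.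
by have [_ _] := inA f fM; rewrite -ef ee eqxx.
Qed.

(** The parts of the blow-up are indexed by 'I_p.+1, enumerated so that the
    heads of missing arcs come first: a matching has at most p.+1./2 of them.
    These first p.+1./2 parts supply one vertex each. *)
Lemma dense_digraph_rainbow (R : realType) (p l : nat) (g : R) :
    (0 < p)%N -> (0 < l)%N -> 0 < g -> g <= 2 ->
  exists n0 : nat, forall (T : finType) (D : rel T) (col : T -> T -> nat),
    (n0 <= #|T|)%N -> (forall a b, col a b = col b a) ->
    (forall a b b', D a b -> D a b' -> col a b = col a b' -> b = b') ->
    (forall x : T,
       2 * (1 - 1 / p%:R) + g <= mean (fun v => (weight D v x)%:R)) ->
  let F := join (complete p.+1./2) (multipartite (uphalf p.+1) l) in
  exists f : 'I_(p.+1./2) + 'I_(uphalf p.+1) * 'I_l -> T,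
    [/\ injective f,
        forall u v, F u v -> D (f u) (f v) || D (f v) (f u)
      & forall u v x y, F u v -> F x y -> col (f u) (f v) = col (f x) (f y) ->
        [set u; v] = [set x; y]].
Proof.
move=> p_gt0 l_gt0 g_gt0 g_le2; pose k0 := Ordinal l_gt0.
pose J := ('I_p.+1 * 'I_l)%type; pose pi (j : J) : J := (j.1, k0).
pose A0 : {set J} := [set j | j.2 == k0].
have cA0 : #|A0| = p.+1.
  rewrite -[RHS]card_ord -(card_imset _ (f := fun i : 'I_p.+1 => (i, k0))).
    apply: eq_card => -[i k]; rewrite inE; apply/eqP/imsetP => [/= ->|[j _ [_ ->]]//].
    by exists i.
  by move=> i j [].
pose a : R := 2 * #|{: J}|%:R + 1.
have a_ge1 : 1 <= a by rewrite lerDr mulr_ge0.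
have a_gt0 : 0 < a by apply: lt_le_trans a_ge1.
pose kappa := g / 2 / a.
have k_gt0 : 0 < kappa by rewrite !divr_gt0.
have k_small : kappa * a <= g / 2 by rewrite divfK// gt_eqF.
have g2 : g / 2 <= 1 by rewrite ler_pdivrMr// mul1r.
have k_le1 : kappa <= 1.
  by rewrite ler_pdivrMr// mul1r (le_trans g2).
pose eps := (kappa ^+ #|{: J * J}|.+1) ^+ p.+1.
have e_gt0 : 0 < eps by rewrite !exprn_gt0.
pose delta := eps ^+ (2 ^ #|setT :\: A0|).
have d_gt0 : 0 < delta by rewrite exprn_gt0.
pose K : R := (#|{: J}| ^ 2 + #|{: J}| ^ 4)%N%:R.
exists (Num.truncn (K / delta)).+1 => T D col n_big colC out_inj mindeg F.
have T_gt0 : (0 < #|T|)%N by apply: leq_trans n_big.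
have [M mM prM] := pr_structure T_gt0 p_gt0 (ltW g_gt0) g_le2 mindeg k_gt0
  k_le1 k_small (eq_leq cA0).
rewrite cA0 -/eps in prM.
have off_irr : irreflexive (off M) by move=> x; rewrite /off eqxx.
have pi_id : {in A0, forall j, pi j = j}.
  by move=> [i k]; rewrite inE => /eqP /= ->.
have pi_in j : pi j \in A0 by rewrite inE.
have prJ := pr_blowup T_gt0 off_irr pi_id pi_in (subsetT A0) (ltW e_gt0) prM.
have small : K / #|T|%:R < delta.
  rewrite ltr_pdivrMr ?ltr0n// mulrC -ltr_pdivrMr//.
  by apply: lt_le_trans (truncnS_gt _) _; rewrite ler_nat.
have [z [zJ z_inj no_coll]] := pr_generic out_inj T_gt0 prJ small.
pose H1 := [set e.2.1 | e in M].
have H1_half : (#|H1| <= p.+1./2)%N.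
  rewrite -[#|H1|]doubleK half_leq//.
  move: (card_matching_heads mM); rewrite cA0; apply: leq_trans.
  rewrite leq_double -(card_imset _ (f := fun i : 'I_p.+1 => (i, k0))).
    apply: subset_leq_card; apply/subsetP => _ /imsetP[_ /imsetP[e eM ->] ->].
    apply/imsetP; exists e => //; have [_ e2 _] := mM.1 e eM.
    by rewrite -{2}(pi_id _ e2).
  by move=> i j [].
have [sg [sg_inj sgH]] := exists_enumeration_from H1.
pose idx (w : 'I_(p.+1./2) + 'I_(uphalf p.+1) * 'I_l) : nat :=
  match w with inl i => i | inr (j, _) => p.+1./2 + j end.
have half_sum : (p.+1./2 + uphalf p.+1)%N = p.+1.
  by rewrite uphalf_half addnCA addnn odd_double_half.
have half_le : (p.+1./2 <= p.+1)%N by rewrite -[leqRHS]half_sum leq_addr.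
have idx_lt w : (idx w < p.+1)%N.
  case: w => [i|[j k]] /=; first exact: leq_trans half_le.
  by rewrite -[ltnRHS]half_sum ltn_add2l.
have sg_idx u w : sg (idx u) = sg (idx w) -> idx u = idx w.
  by apply: sg_inj; rewrite inE.
(* The single vertex of each of the first parts is the copy number k0. *)
pose g' (w : 'I_(p.+1./2) + 'I_(uphalf p.+1) * 'I_l) : J :=
  (sg (idx w), if w is inr (_, k) then k else k0).
have idx_inl (i : 'I_(p.+1./2)) w : idx w = i -> w = inl i.
  case: w => [i' /= /val_inj->//|[j k] /= e].
  by have := ltn_ord i; rewrite -e ltnNge leq_addr.
have g'_inj : injective g'.
  move=> u w [/sg_idx]; case: u => [i|[j k]].
    by move=> /esym /idx_inl->.
  case: w => [i|[j' k']] => [/idx_inl //|/= /addnI/val_inj-> ->//].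
exists (fun w => z (g' w)).
apply: (rainbow_of_generic colC mM zJ z_inj no_coll g'_inj).
  move=> u v uv; rewrite /pi xpair_eqE eqxx andbT /=.
  apply: contraTneq uv => /sg_idx; case: u => [i|[j k]].
    by move=> /esym /idx_inl->; rewrite adj_irrefl.
  case: v => [i|[j' k']] => [/idx_inl->|/= /addnI/val_inj->].
    by rewrite adj_irrefl.
  by rewrite /= eqxx.
move=> e u v eM eu ev; have : idx u = idx v.
  by apply: sg_idx; move: eu; rewrite -ev => -[].
have lt_half : (idx u < p.+1./2)%N.
  apply: leq_trans H1_half; apply: sgH => //; apply/imsetP; exists e => //.
  by rewrite -eu.
move=> uv; rewrite (idx_inl (Ordinal lt_half) v)//.
exact: (idx_inl (Ordinal lt_half)).
Qed.

(** * From average color degree to minimum degree *)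

(** A vertex set maximising (arcs inside) - alpha (size)^2: deleting any of its
    vertices does not increase this quantity, so each vertex has large degree,
    and the quantity is large for V, so the set is large. *)
Lemma exists_min_degree_subset (R : realFieldType) (V : finType) (D : rel V)
    (alpha g : R) : 0 <= alpha -> 
    (alpha + g) * #|V|%:R ^+ 2 <= (\sum_x \sum_y D x y)%:R ->
  exists U : {set V}, g * #|V|%:R ^+ 2 <= #|U|%:R ^+ 2 /\
    {in U, forall x, alpha * (2 * #|U|%:R - 1) <=
       (\sum_(y in U) weight D y x)%:R}.
Proof.
move=> a_ge0 dense.
pose arcs (U : {set V}) := (\sum_(x in U) \sum_(y in U) D x y)%N.
pose phi (U : {set V}) : R := (arcs U)%:R - alpha * #|U|%:R ^+ 2.
have [U _ maxU] := arg_maxP phi (isT : xpredT (setT : {set V})).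
have {maxU} max W : phi W <= phi U by apply: maxU.
exists U; split=> [|x xU].
  have arcsT : arcs setT = (\sum_x \sum_y D x y)%N.
    apply: eq_big => [x|x _]; first by rewrite inE.
    by apply: eq_bigl => y; rewrite inE.
  have arcs_le : (arcs U <= #|U| ^ 2)%N.
    rewrite -mulnn -sum_nat_const leq_sum// => x _.
    by rewrite -sum1_card leq_sum// => y _; case: (D x y).
  have := max setT; rewrite /phi arcsT cardsT => h.
  have : (arcs U)%:R <= #|U|%:R ^+ 2 :> R by rewrite -natrX ler_nat.
  have := sqr_ge0 (#|U|%:R : R); rewrite mulrDl in dense.
  have : 0 <= alpha * #|U|%:R ^+ 2 by rewrite mulr_ge0 ?sqr_ge0.
  move: dense h; set t := (\sum_x _)%N%:R; set aU := (arcs U)%:R.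
  set v2 := #|V|%:R ^+ 2; set u2 := #|U|%:R ^+ 2. lra.
have := max (U :\ x); rewrite /phi.
have cU : #|U| = #|U :\ x|.+1 by rewrite (cardsD1 x) xU.
(* D x x may be an arc, hence only an inequality. *)
have : (arcs U <= arcs (U :\ x) + \sum_(y in U) weight D y x)%N.
  have -> : (\sum_(y in U) weight D y x =
      \sum_(y in U) D y x + \sum_(y in U) D x y)%N by rewrite -big_split.
  have -> : (arcs U = \sum_(y in U) D x y +
      (\sum_(y in U :\ x) D y x + arcs (U :\ x)))%N.
    rewrite -big_split /= /arcs (big_setD1 x)//=; congr addn.
    by apply: eq_bigr => y _; rewrite (big_setD1 x).
  rewrite addnC [leqRHS]addnA leq_add2r addnC leq_add2l.
  by rewrite [leqRHS](big_setD1 x)//= leq_addl.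
rewrite -(ler_nat R) natrD cU -natr1.
set w := (\sum_(y in U) _)%N%:R; set a1 := (arcs U)%:R; set a2 := (arcs _)%:R.
set m := #|_|%:R => h1 h2.
have -> : alpha * (2 * (m + 1) - 1) = alpha * (m + 1) ^+ 2 - alpha * m ^+ 2.
  by ring.
lra.
Qed.

(** The arc kept for a color at u depends on that color only, so no two arcs
    leaving u share a color, while every color at u keeps its arc. *)
Lemma exists_color_orientation (V : finType) (G : sgraph V) (c : coloring V) :
  exists D : rel V,
    [/\ forall u v, D u v -> G u v,
        forall u v v', D u v -> D u v' ->
          c [set u; v] = c [set u; v'] -> v = v'
      & forall u, (color_degree G c u <= \sum_v D u v)%N].
Proof.
pose rep u k := [pick w | G u w && (c [set u; w] == k)].
exists (fun u v => G u v && (rep u (c [set u; v]) == Some v)); split.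
- by move=> u v /andP[].
- by move=> u v v' /andP[_ /eqP h] /andP[_ /eqP h'] e; move: h; rewrite e h' => -[].
move=> u; rewrite -big_mkcond sum1_card /= cardE.
rewrite -(size_map (fun v => c [set u; v])).
apply: uniq_leq_size => [|k]; first exact: undup_uniq.
rewrite mem_undup => /mapP[e]; rewrite mem_filter mem_enum => /andP[ue].
case/imsetP => -[a b]; rewrite inE /= => Gab ee ->{k}.
have [w Guw ew] : exists2 w, G u w & e = [set u; w].
  move: ue; rewrite ee !inE => /orP[]/eqP->; first by exists b.
  by exists a; rewrite 1?adj_sym// setUC.
rewrite ew; case ev : (rep u (c [set u; w])) => [v|]; last first.
  move: ev; rewrite /rep; case: pickP => // /(_ w).
  by rewrite Guw eqxx.
have /andP[Guv /eqP cv] : G u v && (c [set u; v] == c [set u; w]).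
  by move: ev; rewrite /rep; case: pickP => // ? ? [<-].
by rewrite -cv; apply: map_f; rewrite mem_enum unfold_in Guv cv ev eqxx.
Qed.

(** * Existence of rainbow blow-ups *)

Lemma mem_edges (X : finType) (H : sgraph X) x y :
  H x y -> [set x; y] \in edges H.
Proof. by move=> xy; apply/imsetP; exists (x, y); rewrite ?inE. Qed.

Lemma edgesP (X : finType) (H : sgraph X) e :
  e \in edges H -> exists x y, H x y /\ e = [set x; y].
Proof. by case/imsetP => -[x y]; rewrite inE => xy ->; exists x, y. Qed.

Lemma imset_pair (V W : finType) (f : W -> V) x y : f @: [set x; y] = [set f x; f y].
Proof. by rewrite imsetU !imset_set1. Qed.

Section ContainsRainbow.
Variables (V W : finType) (G : sgraph V) (c : coloring V) (F : sgraph W).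

Lemma contains_rainbowP :
  contains_rainbow G c F <->
  exists f : W -> V,
    [/\ injective f, forall u v, F u v -> G (f u) (f v)
      & forall u v x y, F u v -> F x y ->
        c [set f u; f v] = c [set f x; f y] -> [set u; v] = [set x; y]].
Proof.
split=> -[f [f_inj fG f_rb]]; exists f; split=> //.
  move=> u v x y uv xy cc; apply: (imset_inj f_inj); rewrite !imset_pair.
  apply: f_rb => //; rewrite -imset_pair; apply/imsetP.
    by exists [set u; v] => //; apply: mem_edges.
  by exists [set x; y] => //; apply: mem_edges.
move=> e1 e2 /imsetP[d1 /edgesP[u [v [uv ->]]] ->].
move=> /imsetP[d2 /edgesP[x [y [xy ->]]] ->].
by rewrite !imset_pair => cc; rewrite -!imset_pair (f_rb u v x y).
Qed.

End ContainsRainbow.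

Lemma contains_rainbow_sub (V W W' : finType) (G : sgraph V) (c : coloring V)
    (F : sgraph W) (F' : sgraph W') (h : W' -> W) : injective h ->
    (forall u v, F' u v -> F (h u) (h v)) ->
  contains_rainbow G c F -> contains_rainbow G c F'.
Proof.
move=> h_inj hF /contains_rainbowP[f [f_inj fG f_rb]]; apply/contains_rainbowP.
exists (f \o h); split=> [|u v /hF/fG//|u v x y uv xy cc].
  exact: inj_comp.
by apply: (imset_inj h_inj); rewrite !imset_pair; apply: f_rb => //; apply: hF.
Qed.

(** The orientation has at least (1 - 1 / p + gamma) n^2 arcs. A subset of large
    minimum degree of size linear in n suffices, as its own size is the one
    with respect to which its degrees are large. *)
Lemma rainbow_blowup_exists (R : realType) (gamma : R) (l p : nat) :
    0 < gamma -> (0 < l)%N -> (0 < p)%N ->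
  exists n0 : nat, forall (V : finType) (G : sgraph V) (c : coloring V),
    (n0 <= #|V|)%N ->
    (1 - 1 / p%:R + gamma) * #|V|%:R <= avg_color_degree R G c ->
    contains_rainbow G c
      (join (complete p.+1./2) (multipartite (uphalf p.+1) l)).
Proof.
move=> gamma_gt0 l_gt0 p_gt0; pose g := Num.min gamma 1.
have g_gt0 : 0 < g by rewrite lt_min gamma_gt0 ltr01.
have g_le1 : g <= 1 by rewrite ge_min lexx orbT.
have g2_gt0 : 0 < g / 2 by rewrite divr_gt0.
have g2_le2 : g / 2 <= 2 by lra.
have [n1 dense_rb] := dense_digraph_rainbow p_gt0 l_gt0 g2_gt0 g2_le2.
(* The summand 4 / g absorbs the term - alpha in the bound on the degrees. *)
pose m0 : R := n1%:R + 4 / g.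
have m0_gt0 : 0 < m0 by rewrite ltr_wpDl// divr_gt0.
exists (Num.truncn (m0 / (g / 2))).+1 => V G c V_big avg_big.
have V_gt : m0 < g / 2 * #|V|%:R.
  rewrite mulrC -ltr_pdivrMr//.
  by apply: lt_le_trans (truncnS_gt _) _; rewrite ler_nat.
have n_gt0 : 0 < #|V|%:R :> R by rewrite ltr0n; apply: leq_trans V_big.
have [D [DG D_inj D_deg]] := exists_color_orientation G c.
have pp : 0 < p%:R :> R by rewrite ltr0n.
have p_ge1 : 1 <= p%:R :> R by rewrite ler1n.
have pV : 0 <= 1 / p%:R :> R by rewrite divr_ge0// ltW.
have pV1 : 1 / p%:R <= 1 :> R by rewrite ler_pdivrMr// mul1r.
pose alpha : R := 1 - 1 / p%:R + g / 2.
have a_ge0 : 0 <= alpha by rewrite /alpha; lra.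
have a_le2 : alpha <= 2 by rewrite /alpha; lra.
have arcs_big : (alpha + g / 2) * #|V|%:R ^+ 2 <= (\sum_x \sum_y D x y)%:R.
  apply: (@le_trans _ _ (\sum_(v : V) (color_degree G c v)%:R)).
    have e : avg_color_degree R G c * #|V|%:R =
        \sum_(v : V) (color_degree G c v)%:R.
      by rewrite /avg_color_degree divfK// gt_eqF.
    rewrite -e expr2 mulrA ler_wpM2r// ?(ltW n_gt0)//.
    apply: le_trans avg_big; rewrite ler_wpM2r ?(ltW n_gt0)//.
    have : g <= gamma by rewrite ge_min lexx.
    by rewrite /alpha; lra.
  by rewrite natr_sum ler_sum// => v _; rewrite ler_nat.
have [U [U_big U_deg]] := exists_min_degree_subset a_ge0 arcs_big.
have U_gt : m0 < #|U|%:R.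
  rewrite ltNge; apply/negP => U_small.
  have : #|U|%:R < g / 2 * #|V|%:R by apply: le_lt_trans V_gt.
  move: U_big (ler0n R #|U|) n_gt0 g2_gt0 g_le1.
  set u := #|U|%:R; set v := #|V|%:R; set h := g / 2 => uv u0 v0 h0 g1 hu.
  have h1 : h <= 1 by rewrite /h; lra.
  have : u ^+ 2 < (h * v) ^+ 2 by rewrite ltrXn2r ?nnegrE// mulr_ge0 ?ltW.
  rewrite exprMn; have : h ^+ 2 * v ^+ 2 <= h * v ^+ 2.
    by rewrite ler_wpM2r ?sqr_ge0// expr2 ler_piMl// ltW.
  lra.
pose T : finType := {x | x \in U}.
have cT : #|T| = #|U| by rewrite card_sig.
pose DT : rel T := fun x y => D (val x) (val y).
pose colT (x y : T) := c [set val x; val y].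
have [|||x|f [f_inj fD f_rb]] := dense_rb T DT colT.
- rewrite cT -(ler_nat R); apply: ltW; apply: le_lt_trans U_gt.
  by rewrite lerDl divr_ge0// ltW.
- by move=> a b; rewrite /colT setUC.
- by move=> a b b' ab ab' cc; apply/val_inj; apply: (D_inj (val a)).
- have U_gt0 : 0 < #|U|%:R :> R by apply: lt_trans U_gt.
  rewrite /mean cT ler_pdivlMr//.
  have -> : \sum_(v : T) (weight DT v x)%:R =
      (\sum_(y in U) weight D y (val x))%:R :> R by rewrite natr_sum [RHS]big_sub.
  apply: le_trans (U_deg _ (valP x)).
  have : 4 / g < #|U|%:R by apply: le_lt_trans U_gt; rewrite lerDr.
  rewrite ltr_pdivrMr// /alpha; move: a_le2; rewrite /alpha.
  by set u := #|U|%:R; set b := 1 / p%:R; nra.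
apply/contains_rainbowP; exists (fun w => val (f w)); split.
- exact: inj_comp val_inj f_inj.
- by move=> u v /fD/orP[]/DG//; rewrite adj_sym.
- exact: f_rb.
Qed.

(** * Extremal colorings *)

Lemma card_le_color_degree (V : finType) (G : sgraph V) (c : coloring V) u
    (Y : {set V}) :
    {in Y, forall v, G u v} -> {in Y &, injective (fun v => c [set u; v])} ->
  (#|Y| <= color_degree G c u)%N.
Proof.
move=> YG Y_inj; rewrite cardE -(size_map (fun v => c [set u; v])).
apply: uniq_leq_size => [|_ /mapP[v vY ->]].
  by rewrite map_inj_in_uniq ?enum_uniq// => v v'; rewrite !mem_enum; apply: Y_inj.
rewrite mem_enum in vY; rewrite mem_undup; apply: map_f.
by rewrite mem_filter set21 mem_enum mem_edges ?YG.
Qed.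

(** An error term linear in n is absorbed by eps n^2. *)
Lemma asymptotically_sharp_of (R : realType) (W : finType) (F : sgraph W)
    (a : R) :
    (forall n : nat, (0 < n)%N ->
       exists (G : sgraph 'I_n) (c : coloring 'I_n),
         a * n%:R ^+ 2 - n%:R <= (\sum_v color_degree G c v)%:R
         /\ ~ contains_rainbow G c F) ->
  asymptotically_sharp F a.
Proof.
move=> ex eps eps_gt0; exists (Num.truncn (1 / eps)).+1 => n n_big.
have n_gt0 : (0 < n)%N by apply: leq_trans n_big.
have nR : 0 < n%:R :> R by rewrite ltr0n.
have [G [c [deg no]]] := ex n n_gt0; exists 'I_n, G, c; split=> //.
  exact: card_ord.
rewrite /avg_color_degree card_ord ler_pdivlMr// -natr_sum.
apply: le_trans deg; rewrite -mulrA -expr2 mulrBl lerD2l lerN2 expr2 mulrA.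
rewrite ler_peMl ?(ltW nR)// -ler_pdivrMl// mulrC.
by apply: le_trans (ltW (truncnS_gt _)) _; rewrite ler_nat.
Qed.

(** Elements of a residue class are told apart by their quotients. *)
Lemma card_residue_class (n p k : nat) (r : nat) (X : {set 'I_n}) :
    {in X, forall v : 'I_n, (v %% p)%N = r /\ (v <= k)%N} ->
  (#|X| <= (k %/ p)%N.+1)%N.
Proof.
move=> Xr; rewrite -[leqRHS]card_ord.
rewrite -(card_in_imset (f := fun v : 'I_n => inord (v %/ p)%N : 'I_(k %/ p)%N.+1)).
  exact: max_card.
move=> u v /Xr[ur uk] /Xr[vr vk] /(congr1 val).
rewrite /= !inordK ?ltnS ?leq_div2r// => e.
by apply/val_inj; rewrite /= (divn_eq u p) (divn_eq v p) e ur vr.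
Qed.

Lemma divn_le (R : realFieldType) (k p : nat) :
  (k %/ p)%N%:R <= k%:R / p%:R :> R.
Proof.
have [->|p_gt0] := posnP p; first by rewrite divn0 invr0 mulr0.
by rewrite ler_pdivlMr ?ltr0n// -natrM ler_nat leq_divM.
Qed.

(** The Turan graph with all edges of different colors has no complete subgraph
    on more vertices than it has parts. *)
Lemma turan_sharp (R : realType) (p l : nat) : (0 < p)%N -> (0 < l)%N ->
  asymptotically_sharp
    (join (complete p.+1./2) (multipartite (uphalf p.+1) l))
    (1 - 1 / p%:R : R).
Proof.
move=> p_gt0 l_gt0; apply: asymptotically_sharp_of => n n_gt0.
pose e (u v : 'I_n) := (u %% p)%N != (v %% p)%N.
have eS : symmetric e by move=> u v; rewrite /e eq_sym.
have eI : irreflexive e by move=> u; rewrite /e eqxx.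
pose G := SGraph eS eI; pose c : coloring 'I_n := fun d => enum_rank d.
exists G, c; split.
  have deg (u : 'I_n) : n%:R - n%:R / p%:R - 1 <= (color_degree G c u)%:R :> R.
    pose X := [set v : 'I_n | ~~ G u v].
    have cX : (#|X| <= (n %/ p)%N.+1)%N.
      apply: (card_residue_class (r := (u %% p)%N)) => v.
      by rewrite inE negbK => /eqP->; split=> //; apply: ltnW.
    have cY : (#|~: X| <= color_degree G c u)%N.
      apply: card_le_color_degree => [v|v v']; rewrite !inE !negbK// => uv _.
      move=> /val_inj/enum_rank_inj/setP/(_ v); rewrite !inE eqxx orbT.
      by move/esym/orP => [/eqP vu|/eqP//]; rewrite vu adj_irrefl in uv.
    have : (n <= color_degree G c u + (n %/ p)%N.+1)%N.
      by rewrite -[leqLHS]card_ord -(cardsC X) addnC leq_add.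
    rewrite -(ler_nat R) natrD -natr1; have := divn_le R n p; lra.
  apply: (@le_trans _ _ (\sum_(u < n) (n%:R - n%:R / p%:R - 1))); last first.
    by rewrite natr_sum ler_sum.
  rewrite sumr_const card_ord -[_ *+ n]mulr_natr.
  by rewrite le_eqVlt; apply/orP; left; apply/eqP; ring.
case=> f [f_inj fG _].
have [h h_inj hF] := join_contains_complete p.+1 l_gt0.
pose q (i : 'I_p.+1) : 'I_p := Ordinal (ltn_pmod (f (h i)) p_gt0).
have q_inj : injective q.
  move=> i j /(congr1 val) /= qij; apply/eqP; apply: contraT => ij.
  by have := fG _ _ (hF i j ij); rewrite /= /e qij eqxx.
by have := leq_card q q_inj; rewrite !card_ord ltnn.
Qed.

Lemma sum_ord_le (R : realFieldType) (n : nat) :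
  2 * \sum_(u < n) u%:R <= n%:R ^+ 2 :> R.
Proof.
elim: n => [|n IH]; first by rewrite big_ord0 mulr0 sqr_ge0.
rewrite big_ord_recr /= mulrDr -natr1.
by apply: le_trans (lerD IH (lexx _)) _; have := ler0n R n; nra.
Qed.

Section TournamentBlowup.
Variables (n t : nat).
Hypothesis t_gt0 : (0 < t)%N.

Definition one_part (e : {set 'I_n}) : bool :=
  [forall x in e, forall y in e, (x %% t)%N == (y %% t)%N].

(** The transitive tournament on a part is encoded by giving each edge inside
    the part the color of its last vertex; all edges between parts have
    different colors, which n keeps apart from those inside the parts. *)
Definition last_color : coloring 'I_n := fun e =>
  if one_part e then (\max_(x in e) x)%N else (n + enum_rank e)%N.

Lemma one_part_pair (u v : 'I_n) : one_part [set u; v] = ((u %% t)%N == (v %% t)%N).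
Proof.
apply/forall_inP/eqP => [h|uv x].
  have /forall_inP h' := h u (set21 u v).
  exact/eqP/h'/set22.
rewrite !inE => xuv; apply/forall_inP => y; rewrite !inE => yuv.
by case/orP: xuv => /eqP->; case/orP: yuv => /eqP->; rewrite ?uv.
Qed.

Lemma last_color_inside (u v : 'I_n) : (u %% t)%N = (v %% t)%N -> (u < v)%N ->
  last_color [set u; v] = v.
Proof.
move=> /eqP uv uv_lt; rewrite /last_color one_part_pair uv.
rewrite big_setU1 ?inE ?neq_ltn ?uv_lt//= big_set1.
by apply/maxn_idPr/ltnW.
Qed.

Lemma last_color_across (u v : 'I_n) : (u %% t)%N != (v %% t)%N ->
  last_color [set u; v] = (n + enum_rank [set u; v])%N.
Proof. by move=> /negPf uv; rewrite /last_color one_part_pair uv. Qed.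

Lemma last_color_degree (R : realFieldType) (u : 'I_n) :
  n%:R - u%:R / t%:R - 1 <= (color_degree (complete n) last_color u)%:R :> R.
Proof.
pose X := [set v : 'I_n | ((v %% t)%N == (u %% t)%N) && (v <= u)%N].
have cX : (#|X| <= (u %/ t)%N.+1)%N.
  apply: (card_residue_class (r := (u %% t)%N)) => v.
  by rewrite inE => /andP[/eqP].
have outX v : v \in ~: X ->
    (u != v) /\
    (((u %% t)%N != (v %% t)%N) \/ ((u %% t)%N = (v %% t)%N /\ (u < v)%N)).
  rewrite !inE => vX; split; first by apply: contraNneq vX => ->; rewrite eqxx /=.
  have [e|] := eqVneq ((u %% t)%N) ((v %% t)%N); last by left.
  by right; split=> //; rewrite ltnNge; move: vX; rewrite e eqxx.
have cY : (#|~: X| <= color_degree (complete n) last_color u)%N.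
  apply: card_le_color_degree => [v /outX[]//|v v' /outX[uv hv] /outX[uv' hv']].
  case: hv => [av|[iv lv]]; case: hv' => [av'|[iv' lv']].
  - rewrite !last_color_across// => /addnI/val_inj/enum_rank_inj/setP/(_ v).
    rewrite !inE eqxx orbT => /esym/orP[/eqP vu|/eqP//].
    by rewrite vu eqxx in uv.
  - rewrite last_color_across// last_color_inside// => e.
    by have := ltn_ord v'; rewrite -e ltnNge leq_addr.
  - rewrite last_color_inside// last_color_across// => e.
    by have := ltn_ord v; rewrite e ltnNge leq_addr.
  - by rewrite !last_color_inside// => /val_inj.
have : (n <= color_degree (complete n) last_color u + (u %/ t)%N.+1)%N.
  by rewrite -[leqLHS]card_ord -(cardsC X) addnC leq_add.
rewrite -(ler_nat R) natrD -natr1; have := divn_le R u t; lra.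
Qed.

Lemma sum_last_color_degree (R : realFieldType) :
  (1 - 1 / (2 * t%:R)) * n%:R ^+ 2 - n%:R <=
    (\sum_u color_degree (complete n) last_color u)%:R :> R.
Proof.
rewrite natr_sum; apply: le_trans (ler_sum _ (fun u _ => last_color_degree R u)).
rewrite !sumrB !sumr_const card_ord -mulr_suml -[n%:R *+ n]mulr_natr.
rewrite -expr2 lerD2r.
have tt : 0 < t%:R^-1 :> R by rewrite invr_gt0 ltr0n.
have := ler_wpM2r (ltW tt) (sum_ord_le R n); rewrite div1r invfM.
by set S := \sum_u _; move: S => S; set b := t%:R^-1; lra.
Qed.

(** In each of the t parts, the last vertex of the copy has at most one neighbor
    in the copy, as the edges from its neighbors all have its color. So each
    part contains at most one vertex outside the class of its last vertex. The
    last vertices meet at most t of the r + t + 1 classes, so r + 1 classes are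
    missed. Only r classes are single vertices, so one missed class has l
    vertices, and the r others have at least one each. All these r + l vertices
    lie in different parts. *)
Lemma last_color_rainbow_card (r l : nat) : (0 < l)%N ->
    contains_rainbow (complete n) last_color
      (join (complete r) (multipartite t.+1 l)) ->
  (r + l <= t)%N.
Proof.
move=> l_gt0 /contains_rainbowP[f [f_inj _ f_rb]].
set F := join _ _ in f_rb.
pose W := ('I_r + 'I_t.+1 * 'I_l)%type.
pose cls (w : W) : 'I_r + 'I_t.+1 :=
  match w with inl i => inl i | inr x => inr x.1 end.
have clsF u v : cls u != cls v -> F u v by case: u => [?|?]; case: v => [?|?].
pose part (w : W) : 'I_t := Ordinal (ltn_pmod (f w) t_gt0).
(* The last vertices of the parts, and the classes that they meet. *)
pose L := [set u | [forall w, (part w == part u) ==> (f w <= f u)%N]].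
have LP u w : u \in L -> part w = part u -> (f w <= f u)%N.
  by rewrite inE => /forallP/(_ w)/implyP h /eqP/h.
have cL : (#|L| <= t)%N.
  rewrite -[t in leqRHS]card_ord -(card_in_imset (f := part)) ?max_card//.
  move=> u v uL vL e; apply/f_inj/val_inj/eqP.
  by rewrite eqn_leq (LP v u)// (LP u v).
pose C := cls @: L.
have cC : (#|C| <= t)%N by apply: leq_trans (leq_imset_card _ _) cL.
(* A vertex outside these classes is the only one of its part. *)
pose N := [set w | cls w \notin C].
have cN : (#|N| <= t)%N.
  rewrite -[t in leqRHS]card_ord -(card_in_imset (f := part)) ?max_card//.
  move=> w w'; rewrite !inE => wN wN' e.
  have [u uL uw] : exists2 u, u \in L & part u = part w.
    case: (@arg_maxnP _ w (fun x => part x == part w) f (eqxx _)).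
    move=> u /eqP uw umax; exists u => //; rewrite inE; apply/forallP => x.
    by apply/implyP => /eqP xu; apply: umax; rewrite xu uw.
  have ne x : cls x \notin C -> part x = part u ->
      F x u /\ last_color [set f x; f u] = f u.
    move=> xC xu; have xu' : cls x != cls u.
      by apply: contraNneq xC => ->; apply: imset_f.
    split; first exact: clsF.
    apply: last_color_inside; first exact: (congr1 val xu).
    rewrite ltn_neqAle LP// andbT; apply: contraNneq xu' => e'.
    by rewrite (f_inj x u)//; apply: val_inj.
  have [Fw cw] := ne w wN (esym uw).
  have [Fw' cw'] := ne w' wN' (etrans (esym e) (esym uw)).
  have := f_rb w u w' u Fw Fw'; rewrite cw cw' => /(_ erefl)/setP/(_ w).
  rewrite !inE eqxx => /esym/orP[/eqP//|/eqP wu].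
  by rewrite wu adj_irrefl in Fw.
have cC' : (r < #|~: C|)%N.
  have := cardsC C; rewrite card_sum !card_ord; lia.
have [j jC] : exists j : 'I_t.+1, inr j \notin C.
  apply/existsP; apply: contraLR cC'; rewrite negb_exists => /forallP all_in.
  rewrite -leqNgt -[r in leqRHS]card_ord.
  rewrite -(card_imset _ (f := @inl 'I_r 'I_t.+1)); last by move=> ? ? [].
  apply: subset_leq_card; apply/subsetP => -[i _|i]; first exact: imset_f.
  by rewrite inE (negPf (all_in i)).
pose k0 := Ordinal l_gt0.
pose rep (x : 'I_r + 'I_t.+1) : W :=
  match x with inl i => inl i | inr j => inr (j, k0) end.
have repK : cancel rep cls by case.
pose N1 : {set W} := [set inr (j, k) | k : 'I_l].
pose N2 := rep @: (~: C :\ inr j).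
have cN1 : #|N1| = l by rewrite card_imset ?card_ord// => k k' [].
have cN2 : (r <= #|N2|)%N.
  rewrite card_imset; last exact: can_inj repK.
  by move: cC'; rewrite (cardsD1 (inr j)) inE jC.
have dis : N1 :&: N2 = set0.
  apply/setP => w; rewrite !inE; apply/negP.
  case/andP => /imsetP[k _ ->] /imsetP[x]; rewrite !inE => /andP[xj _].
  by move=> e; case/eqP: xj; rewrite -[x]repK -e.
apply: leq_trans cN; rewrite addnC.
apply: leq_trans (leq_add (eq_leq (esym cN1)) cN2) _.
rewrite -cardsUI dis cards0 addn0; apply: subset_leq_card.
apply/subsetP => w; rewrite !inE => /orP[/imsetP[k _ ->]//|/imsetP[x]].
by rewrite !inE => /andP[_ xC] ->; rewrite repK.
Qed.

End TournamentBlowup.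

(** * The threshold for rainbow blow-ups *)

Theorem theorem1p4 (R : realType) (gamma : R) (l r s : nat)
    (gamma_gt0 : 0 < gamma) (l_ge1 : (1 <= l)%N)
    (s_ge : (maxn (1 + 2 * r) 2 <= s)%N) :
  [/\ exists n0 : nat,
        forall (n : nat) (V : finType) (G : sgraph V) (c : coloring V),
          (n0 <= n)%N -> #|V| = n ->
          ((1 - 1 / (s%:R - 1) + gamma) * n%:R <= avg_color_degree R G c ->
             contains_rainbow G c
               (join (complete s./2) (multipartite (uphalf s) l)))
          /\
          ((1 - 1 / (2 * (s%:R - 1 - r%:R)) + gamma) * n%:R
             <= avg_color_degree R G c ->
             contains_rainbow G c
               (join (complete r) (multipartite (s - r) l))),
      asymptotically_sharp (join (complete s./2) (multipartite (uphalf s) l))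
        (1 - 1 / (s%:R - 1) : R)
    & (s <= l + 2 * r)%N ->
      asymptotically_sharp (join (complete r) (multipartite (s - r) l))
        (1 - 1 / (2 * (s%:R - 1 - r%:R)) : R)].
Proof.
have [p p_gt0 es] : exists2 p, (0 < p)%N & s = p.+1 by exists s.-1; lia.
have [t [t_gt0 et rt]] : exists t, [/\ (0 < t)%N, p = t + r & (r <= t)%N].
  by exists (p - r)%N; split; lia.
have sR : s%:R - 1 = p%:R :> R by rewrite es -natr1 addrK.
have tR : s%:R - 1 - r%:R = t%:R :> R by rewrite sR et natrD addrK.
have esr : (s - r = t.+1)%N by lia.
rewrite tR sR esr es.
have t2_gt0 : (0 < t.*2)%N by rewrite double_gt0.
(* The bound of the second part is that of the first one for 2 t + 1 in place of
   s, and as r <= t the graph of the first part then contains that of the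
   second. *)
have [n1 ex1] := rainbow_blowup_exists gamma_gt0 l_ge1 p_gt0.
have [n2 ex2] := rainbow_blowup_exists gamma_gt0 l_ge1 t2_gt0.
split; last 1 first.
- move=> small; apply: asymptotically_sharp_of => n n_gt0.
  exists (complete n), (last_color t); split.
    exact: sum_last_color_degree.
  by move=> /(last_color_rainbow_card t_gt0 l_ge1); lia.
- exists (maxn n1 n2) => n V G c; rewrite geq_max => /andP[n1n n2n] cV.
  subst n; split=> [|avg2]; first exact: ex1.
  have := ex2 V G c n2n; rewrite -mul2n natrM => /(_ avg2).
  have -> : (2 * t).+1./2 = t by lia.
  have -> : uphalf (2 * t).+1 = t.+1 by lia.
  pose h (w : 'I_r + 'I_t.+1 * 'I_l) : 'I_t + 'I_t.+1 * 'I_l :=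
    match w with inl i => inl (widen_ord rt i) | inr x => inr x end.
  apply: (contains_rainbow_sub (h := h)).
    by move=> [i|x] [j|y] //= [] => [/val_inj->|->].
  by move=> [i|x] [j|y].
- exact: turan_sharp.
Qed.
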